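(* Let $\pi$ be a probability measure on $(0,+\infty)$ that is absolutely continuous with a smooth density and satisfies $\int_0^{+\infty}\frac1r\pi(dr)<+\infty$. For $n=2^m$ with $m\in\mathbb{N}$, let the quantile-based nodes $r_1,\dots,r_n$ and weights $c_1,\dots,c_n$ be defined as in the context, and let $\pi_n(dr)=\sum_{i=1}^nc_i\delta(r-r_i)$, with $n=2^m$. Then $$\lim_{m\to+\infty}\int_0^{+\infty}\frac1r\,\pi_n(dr)=\lim_{m\to+\infty}\sum_{i=1}^{n}\frac{c_i}{r_i}=\int_0^{+\infty}\frac1r\,\pi(dr).$$
   Context: For a positive integer $N$ and $k=0,1,\dots,N$, the quantile $\theta_{N,k}\in[0,+\infty]$ is determined by $\frac kN=\int_0^{\theta_{N,k}}\pi(dr)$, with $\theta_{N,0}=0$ and $\theta_{N,N}=+\infty$; for $1\le k\le N-1$ this quantile is assumed to be uniquely determined. For $n=2^m$, set $r_i=\theta_{2n,2i-1}$ and $c_i=\int_{\theta_{2n,2i-2}}^{\theta_{2n,2i}}\pi(dr)=\frac1n$ for $1\le i\le n$. Here $\delta(r-r_i)$ denotes the Dirac mass at $r_i$. *)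

(* Defs.v *)
From HB Require Import structures.
From mathcomp Require Import all_boot all_order all_algebra.
From mathcomp Require Import all_classical all_reals all_analysis.
Set Implicit Arguments.
Unset Strict Implicit.
Unset Printing Implicit Defensive.
Import Order.TTheory GRing.Theory Num.Theory.
Import numFieldNormedType.Exports.
Local Open Scope classical_set_scope.
Local Open Scope ring_scope.

(* C^infinity on the open half-line; the values of f on ]-oo, 0] are
   irrelevant since derivatives at x > 0 are local. *)
Definition smooth_on_pos (R : realType) (f : R -> R) : Prop :=
  forall (k : nat) (x : R), 0 < x -> derivable (derive1n k f) x 1.

(* A measure on (0, +oo) is represented by a probability on R giving full mass
   to ]0, +oo[. *)
Definition supported_on_pos (R : realType)
    (P : probability (measurableTypeR R) R) : Prop :=
  P `]0, +oo[%classic = 1%E.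

(* Existence of a Lebesgue density on ]0, +oo[, which contains absolute
   continuity. *)
Definition has_smooth_density (R : realType)
    (P : probability (measurableTypeR R) R) : Prop :=
  exists f : R -> R,
    [/\ smooth_on_pos f,
        (forall x, 0 < x -> 0 <= f x) &
        forall A : set (measurableTypeR R), measurable A -> A `<=` `]0, +oo[%classic ->
          P A = (\int[lebesgue_measure]_(x in A) (f x)%:E)%E].

(* The part of ]0, +oo[ lying in ]s, t], with endpoints in [0, +oo]. *)
Definition slice (R : realType) (s t : \bar R) : set (measurableTypeR R) :=
  [set x : R | 0 < x /\ (s < x%:E)%E /\ (x%:E <= t)%E].

Definition is_quantile (R : realType) (P : probability (measurableTypeR R) R)
    (N k : nat) (t : \bar R) : Prop :=
  (0 <= t)%E /\ P (slice 0%E t) = (k%:R / N%:R)%:E.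

Definition quantiles_unique (R : realType)
    (P : probability (measurableTypeR R) R) : Prop :=
  forall N k : nat, (1 <= k)%N -> (k <= N.-1)%N ->
    exists! t : \bar R, is_quantile P N k t.

(* Meaningful for k <= N; for 0 < k < N the value is the chosen quantile,
   which is the only one under quantiles_unique. *)
Definition quantile (R : realType) (P : probability (measurableTypeR R) R)
    (N k : nat) : \bar R :=
  if k == 0%N then 0%E else if k == N then +oo%E
  else xget 0%E [set t | is_quantile P N k t].

(* Nodes and weights are indexed by 1 <= i <= n.  For such i the quantile
   defining the node is finite, because 0 < (2i-1)/(2n) < 1, so that fine
   loses nothing. *)
Definition node (R : realType) (P : probability (measurableTypeR R) R)
    (n i : nat) : R :=
  fine (quantile P (2 * n) (2 * i - 1)).

Definition weight (R : realType) (P : probability (measurableTypeR R) R)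
    (n i : nat) : R :=
  fine (P (slice (quantile P (2 * n) (2 * i - 2)) (quantile P (2 * n) (2 * i)))).

Lemma weight_ge0 (R : realType) (P : probability (measurableTypeR R) R)
    (n i : nat) : 0 <= weight P n i.
Proof. by apply: fine_ge0; exact: measure_ge0. Qed.

Definition quantized (R : realType) (P : probability (measurableTypeR R) R)
    (n : nat) : {measure set (measurableTypeR R) -> \bar R} :=
  msum (fun j : nat => mscale (NngNum (weight_ge0 P n j.+1))
                              (dirac (node P n j.+1 : measurableTypeR R))) n.

(* Main.v *)
Require Import Defs.
From HB Require Import structures.
From mathcomp Require Import all_boot all_order all_algebra.
From mathcomp Require Import all_classical all_reals all_analysis.
From mathcomp Require Import measurable_realfun zify lra.

(** Write q_k for the k-th quantile of order 2n, F k for the integral of 1/r over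
    ]0, q_k], and a_k = 1 / (2n q_k).  Each slice ]q_k, q_{k+1}] has mass 1/(2n)
    and 1/r decreases, so F (k+1) - F k <= a_k <= F k - F (k-1).  The quantized
    integral is the sum of the 2 a_k over odd k; bounding one copy of a_k by the
    slice next to q_k and the other one by the following slice, the sums
    telescope and the error is at most F 1, the integral of 1/r over the first
    slice.  That slice has mass 1/(2n), so F 1 tends to 0 by absolute continuity
    of the integral. *)

Set Implicit Arguments.
Unset Strict Implicit.
Unset Printing Implicit Defensive.
Import Order.TTheory GRing.Theory Num.Theory.
Import numFieldNormedType.Exports.
Local Open Scope classical_set_scope.
Local Open Scope ring_scope.

(** Since [a k] separates the increments of [F] after and before [k], these increments are
    nonincreasing; an odd-indexed term can thus be compared with an increment one step further
    away. *)
Lemma odd_sum_sandwich (R : realFieldType) (F a : nat -> R) (n : nat) :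
  (0 < n)%N -> F 0%N = 0 ->
  (forall k, (k < 2 * n)%N -> F k <= F k.+1) ->
  (forall k, (0 < k < 2 * n)%N -> F k.+1 - F k <= a k <= F k - F k.-1) ->
  `|\sum_(i < n) (2 * a (2 * i + 1)%N) - F (2 * n)%N| <= F 1%N.
Proof.
case: n => // n _ F0 ndF ha.
have oddE i : (2 * i + 1 = (2 * i).+1)%N by rewrite addn1.
have evenS i : (2 * i.+1 = (2 * i).+2)%N by rewrite mulnS.
have ha1 i : (i <= n)%N ->
    F (2 * i).+2 - F (2 * i).+1 <= a (2 * i).+1 <= F (2 * i).+1 - F (2 * i)%N.
  by move=> le_in; apply: ha; lia.
have ha2 i : (i < n)%N ->
    F (2 * i).+3 - F (2 * i).+2 <= a (2 * i).+2 <= F (2 * i).+2 - F (2 * i).+1.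
  by move=> lt_in; apply: ha; lia.
(* Both copies of [a (2j+3)] use earlier increments, the second one through [a (2j+2)]. Index 1 has
   only one increment below it, used twice: hence the extra [F 1]. *)
have upper j : (j <= n)%N ->
    \sum_(i < j.+1) (2 * a (2 * i + 1)%N) <= F (2 * j).+1 + F 1%N.
  elim: j => [|j IHj] jn.
    have /andP[_] := ha1 0%N isT.
    by rewrite big_ord_recr big_ord0 /= oddE muln0 F0; lra.
  rewrite big_ord_recr /= oddE.
  have /andP[_] := ha1 j.+1 jn; have /andP[+ _] := ha1 j.+1 jn.
  have /andP[] := ha2 j jn; have := IHj (ltnW jn).
  by rewrite evenS; lra.
(* Both copies now use later increments. The last odd index [2n+1] is left out, having only one
   later increment in range; its term is added at the end, where [F (2n+1) <= F (2n+2)] suffices. *)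
have lower j : (j <= n)%N ->
    F (2 * j).+1 - F 1%N <= \sum_(i < j) (2 * a (2 * i + 1)%N).
  elim: j => [|j IHj] jn; first by rewrite big_ord0 muln0 subrr.
  rewrite big_ord_recr /= oddE.
  have /andP[+ _] := ha1 j (ltnW jn); have /andP[] := ha2 j jn.
  by have := IHj (ltnW jn); rewrite evenS; lra.
have /andP[+ _] := ha1 n (leqnn n).
have := upper n (leqnn n); have := lower n (leqnn n).
have : F (2 * n).+1 <= F (2 * n).+2 by apply: ndF; lia.
rewrite ler_norml evenS big_ord_recr /= oddE.
by move=> ndn lo up ln; apply/andP; split; lra.
Qed.

(** * Slices of the half-line *)

Lemma slice_measurable (R : realType) (s t : \bar R) : measurable (slice s t).
Proof.
have -> : slice s t =
    `]0, +oo[%classic `&` EFin @^-1` (`]s, t]%classic : set (\bar R)).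
  apply/seteqP; split => x /=; rewrite in_itv/= andbT.
    by move=> [? [sx xt]]; split => //; rewrite /= in_itv/= sx.
  by move=> [?]; rewrite in_itv/= => /andP[].
by apply: EFin_measurable => //; exact: measurable_realfun.emeasurable_itv.
Qed.

Lemma slice0y (R : realType) : slice 0 +oo = `]0, +oo[%classic :> set R.
Proof.
apply/seteqP; split => x /=; rewrite in_itv/= andbT; first by case.
by move=> x0; split => //; rewrite lte_fin leey.
Qed.

Lemma slicexx (R : realType) (t : \bar R) : slice t t = set0.
Proof.
apply/seteqP; split => x //= [_ [tx xt]].
by have := lt_le_trans tx xt; rewrite ltxx.
Qed.

Lemma slice_cat (R : realType) (s t u : \bar R) : (s <= t)%E -> (t <= u)%E ->
  slice s u = slice s t `|` slice t u.
Proof.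
move=> st tu; apply/seteqP; split => x /=.
  move=> [x0 [sx xu]]; have [xt|tx] := leP x%:E t; first by left.
  by right.
move=> [[x0 [sx xt]]|[x0 [tx xu]]]; do 2!split => //.
  exact: le_trans xt tu.
exact: le_lt_trans st tx.
Qed.

Lemma slice_disj (R : realType) (s t u : \bar R) : slice s t `&` slice t u = set0.
Proof.
apply/seteqP; split => x //= [[_ [_ xt]] [_ [tx _]]].
by have := lt_le_trans tx xt; rewrite ltxx.
Qed.

Lemma sub_slice_pos (R : realType) (s t : \bar R) :
  slice s t `<=` `]0, +oo[%classic.
Proof. by move=> x [x0 _] /=; rewrite in_itv/= x0. Qed.

Lemma measurable_inv_pos (R : realType) :
  measurable_fun (`]0, +oo[%classic : set R) (fun r : R => (r^-1)%:E).
Proof.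
apply/measurable_EFinP; apply: open_continuous_measurable_fun.
  exact: interval_open.
move=> x; rewrite inE/= in_itv/= andbT => x0.
by apply: inv_continuous; rewrite gt_eqF.
Qed.

(** * Quantiles, nodes and weights *)

Section Quantiles.
Context (R : realType) (P : probability (measurableTypeR R) R).
Hypothesis hsupp : supported_on_pos P.
Hypothesis hquant : quantiles_unique P.

Let slice_cat_measure (s t u : \bar R) : (s <= t)%E -> (t <= u)%E ->
  P (slice s u) = (P (slice s t) + P (slice t u))%E.
Proof.
move=> st tu; rewrite (slice_cat st tu) measureU//.
- exact: slice_measurable.
- exact: slice_measurable.
- exact: slice_disj.
Qed.

(** The conventional values at both ends fit the general equation: the slice is empty for [k = 0],
    and has full mass by [hsupp] for [k = N]. In between, [hquant] provides a point for [xget] to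
    choose. *)
Lemma quantileP (N k : nat) : (0 < N)%N -> (k <= N)%N ->
  is_quantile P N k (quantile P N k).
Proof.
move=> N0 kN; rewrite /quantile; case: eqVneq => [->|k0].
  by split => //; rewrite slicexx measure0 mul0r.
case: eqVneq => [->|kN'].
  split; first exact: leey.
  by rewrite slice0y hsupp divff// pnatr_eq0; lia.
have [||t [tP _]] := hquant (N := N) (k := k); [lia..|].
by have /= := xgetPex 0%E (ex_intro [set t | is_quantile P N k t] t tP).
Qed.

Lemma quantile_lt (N k l : nat) : (0 < N)%N -> (k < l)%N -> (l <= N)%N ->
  (quantile P N k < quantile P N l)%E.
Proof.
move=> N0 kl lN; rewrite ltNge; apply/negP => le_lk.
have [k0 Pk] := quantileP N0 (leq_trans (ltnW kl) lN).
have [l0 Pl] := quantileP N0 lN.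
(* Quantiles in the wrong order would give [l/N <= k/N]. *)
have : (P (slice 0 (quantile P N l)) <= P (slice 0 (quantile P N k)))%E.
  by rewrite [leRHS](slice_cat_measure l0 le_lk) leeDl.
rewrite Pk Pl lee_fin ler_pM2r ?invr_gt0 ?ltr0n// ler_nat leqNgt.
by rewrite kl.
Qed.

Lemma quantile_le (N k l : nat) : (0 < N)%N -> (k <= l)%N -> (l <= N)%N ->
  (quantile P N k <= quantile P N l)%E.
Proof.
by move=> N0; rewrite leq_eqVlt => /predU1P[->//|kl] lN; exact/ltW/quantile_lt.
Qed.

Lemma quantile_slice (N k l : nat) : (0 < N)%N -> (k <= l)%N -> (l <= N)%N ->
  P (slice (quantile P N k) (quantile P N l)) = ((l - k)%N%:R / N%:R)%:E.
Proof.
move=> N0 kl lN.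
have [k0 Pk] := quantileP N0 (leq_trans kl lN).
have [l0 Pl] := quantileP N0 lN.
move: Pl; rewrite (slice_cat_measure k0 (quantile_le N0 kl lN)) Pk.
have : P (slice (quantile P N k) (quantile P N l)) \is a fin_num.
  by apply: fin_num_measure; exact: slice_measurable.
case: (P _) => // p _ [] pE; congr EFin.
by rewrite natrB// mulrBl -pE addrAC subrr add0r.
Qed.

Lemma quantile_fin (N k : nat) : (0 < k < N)%N ->
  quantile P N k = (fine (quantile P N k))%:E.
Proof.
move=> /andP[k0 kN]; rewrite fineK// fin_numE; apply/andP; split.
  by rewrite gt_eqF// (lt_le_trans ltNy0)//; have [] := quantileP (leq_trans k0 (ltnW kN)) (ltnW kN).
(* The quantile of index [N] is +oo, so a strictly smaller one is finite. *)
have := @quantile_lt N k N (leq_trans k0 (ltnW kN)) kN (leqnn N).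
by apply: contraTneq => ->; rewrite -leNgt leey.
Qed.

Lemma fine_quantile_gt0 (N k : nat) : (0 < k < N)%N -> 0 < fine (quantile P N k).
Proof.
move=> kN; rewrite -lte_fin -quantile_fin//.
have -> : 0%:E = quantile P N 0 by [].
by apply: quantile_lt; lia.
Qed.

Lemma node_gt0 (n i : nat) : (0 < i <= n)%N -> 0 < node P n i.
Proof. by move=> ?; apply: fine_quantile_gt0; lia. Qed.

Lemma weightE (n i : nat) : (0 < i <= n)%N -> weight P n i = n%:R^-1.
Proof.
move=> /andP[i0 ilen]; rewrite /weight quantile_slice; [|lia..].
have -> : (2 * i - (2 * i - 2) = 2)%N by lia.
by rewrite /= natrM invfM mulrA divff ?mul1r// pnatr_eq0.
Qed.

Lemma integral_quantized (n : nat) :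
  (\int[quantized P n]_(r in `]0%R, +oo[%classic) (r^-1)%:E)%E =
  (\sum_(i < n) weight P n i.+1 / node P n i.+1)%:E.
Proof.
have h0 (x : R) : `]0, +oo[%classic x -> (0 <= (x^-1)%:E)%E.
  by rewrite /= in_itv/= andbT lee_fin invr_ge0 => /ltW.
have mh := @measurable_inv_pos R.
rewrite /quantized ge0_integral_measure_sum// -sumEFin.
apply: eq_bigr => i _; rewrite ge0_integral_mscale// integral_dirac//.
(* Every node is positive, so no Dirac mass falls outside the domain of integration. *)
rewrite diracE mem_set/= ?mul1e// in_itv/= andbT.
by apply: node_gt0; rewrite ltn_ord.
Qed.

(** * The integral of 1/r over slices and the quantization error *)

Hypothesis hint : (\int[P]_(r in `]0%R, +oo[%classic) (r^-1)%:E < +oo)%E.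

Let I (A : set (measurableTypeR R)) := (\int[P]_(r in A) (r^-1)%:E)%E.

Let integrand_ge0 (s t : \bar R) x : slice s t x -> (0 <= (x^-1)%:E)%E.
Proof. by move=> [x0 _]; rewrite lee_fin invr_ge0 ltW. Qed.

Let integrand_measurable (s t : \bar R) :
  measurable_fun (slice s t) (fun r : R => (r^-1)%:E).
Proof.
apply: (measurable_funS _ (@sub_slice_pos R s t) (@measurable_inv_pos R)).
exact: measurable_itv.
Qed.

Let I_ge0 s t : (0 <= I (slice s t))%E.
Proof. by apply: integral_ge0 => x; exact: integrand_ge0. Qed.

Let I_fin s t : I (slice s t) \is a fin_num.
Proof.
rewrite ge0_fin_numE//; apply: le_lt_trans hint; apply: ge0_subset_integral.
- exact: slice_measurable.
- exact: measurable_itv.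
- exact: measurable_inv_pos.
- by move=> x /=; rewrite in_itv/= andbT lee_fin invr_ge0 => /ltW.
- exact: sub_slice_pos.
Qed.

Let I_cat s t u : (s <= t)%E -> (t <= u)%E ->
  I (slice s u) = (I (slice s t) + I (slice t u))%E.
Proof.
move=> st tu; rewrite /I (slice_cat st tu) ge0_integral_setU//.
- exact: slice_measurable.
- exact: slice_measurable.
- by rewrite -slice_cat.
- by rewrite -slice_cat//; exact: integrand_ge0.
- by apply/disj_setPS; rewrite slice_disj.
Qed.

Let I_ge s (t : R) : 0 < t -> (P (slice s t%:E) * (t^-1)%:E <= I (slice s t%:E))%E.
Proof.
move=> t0; rewrite muleC -integral_cst; last exact: slice_measurable.
apply: ge0_le_integral => //.
- exact: slice_measurable.
- by move=> x _; rewrite lee_fin invr_ge0 ltW.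
- by move=> x [x0 [_]]; rewrite !lee_fin lef_pV2.
Qed.

(** On the slice, 1/r is at most the constant 1/s. The right endpoint stays extended so as to cover
    the last slice, which ends at +oo. *)
Let I_le (s : R) t : 0 < s -> (I (slice s%:E t) <= P (slice s%:E t) * (s^-1)%:E)%E.
Proof.
move=> s0; rewrite muleC -integral_cst; last exact: slice_measurable.
apply: ge0_le_integral => //.
- exact: slice_measurable.
- by move=> x; exact: integrand_ge0.
- by move=> x [x0 [+ _]]; rewrite lte_fin lee_fin => /ltW; rewrite lef_pV2.
Qed.

Lemma quantized_error (n : nat) : (0 < n)%N ->
  `|\sum_(i < n) weight P n i.+1 / node P n i.+1 - fine (I `]0, +oo[%classic)|
  <= fine (I (slice 0 (quantile P (2 * n) 1))).
Proof.
move=> n0; have N0 : (0 < 2 * n)%N by lia.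
pose q k := quantile P (2 * n) k.
pose F k := fine (I (slice 0 (q k))).
(* Half a weight over a quantile, whence the factor 2 below. At [k = 2n], [fine] turns +oo into 0,
   but the bounds on [a k] only concern [0 < k < 2n]. *)
pose a k := (2 * n)%:R^-1 / fine (q k).
have q0 k : (k <= 2 * n)%N -> (0 <= q k)%E.
  by move=> kn; apply: (quantileP _ _).1.
have q_le k : (k < 2 * n)%N -> (q k <= q k.+1)%E.
  by move=> kn; apply: quantile_le.
have FB k : (k < 2 * n)%N -> F k.+1 - F k = fine (I (slice (q k) (q k.+1))).
  move=> kn; rewrite /F (I_cat (q0 _ (ltnW kn)) (q_le _ kn)).
  by rewrite fineD// addrAC subrr add0r.
have Pq k : (k < 2 * n)%N -> P (slice (q k) (q k.+1)) = ((2 * n)%:R^-1)%:E.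
  by move=> kn; rewrite quantile_slice// subSnn mul1r.
have -> : fine (I `]0, +oo[%classic) = F (2 * n)%N.
  by rewrite /F /q /quantile eqxx gtn_eqF// slice0y.
have -> : \sum_(i < n) weight P n i.+1 / node P n i.+1 =
    \sum_(i < n) (2 * a (2 * i + 1)%N).
  apply: eq_bigr => i _; rewrite weightE ?ltn_ord// /node /a mulrA natrM invfM.
  rewrite mulrA divff ?mul1r ?pnatr_eq0//.
  by congr (_ / fine (quantile _ _ _)); lia.
apply: odd_sum_sandwich => //.
- by rewrite /F /q /quantile/= slicexx /I integral_set0.
- by move=> k kn; rewrite -subr_ge0 FB// fine_ge0.
- move=> [//|k] /andP[_ kn]; rewrite FB// FB ?(ltnW kn)//=.
  have qk : q k.+1 = (fine (q k.+1))%:E by apply: quantile_fin; lia.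
  have qk0 : 0 < fine (q k.+1) by apply: fine_quantile_gt0; lia.
  rewrite -!lee_fin !fineK// /a EFinM.
  (* The factor 1/(2n) is read as the mass of the following slice in the lower bound on [a], and of
     the preceding slice in the upper one. *)
  rewrite -{1}(Pq k.+1 kn) -(Pq k (ltnW kn)) qk.
  by rewrite /=; apply/andP; split; [exact: I_le|exact: I_ge].
Qed.

Lemma first_slice_cvg0 (e : R) : 0 < e ->
  \forall n \near \oo, fine (I (slice 0 (quantile P (2 * n) 1))) < e.
Proof.
move=> e0; pose D : set (measurableTypeR R) := `]0, +oo[%classic.
have mD : measurable D by exact: measurable_itv.
have Df : (EFin \o (fun x : R => x^-1)) \_ D = EFin \o ((fun x : R => x^-1) \_ D).
  exact: restrict_EFin.
(* Absolute continuity of the integral is applied on the whole line, so 1/r is extended by 0 off the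
   half-line. *)
have intf : P.-integrable setT (EFin \o ((fun x : R => x^-1) \_ D)).
  rewrite -Df; apply/(integrable_mkcond _ mD); apply/integrableP; split.
    exact: measurable_inv_pos.
  under eq_integral => x.
    rewrite inE /D/= in_itv/= andbT => x0.
    rewrite ger0_norm ?invr_ge0 ?ltW//; over.
  exact: hint.
have [d [d0 dP]] := integral_normr_continuous intf e0.
have inv_small := near_infty_natSinv_lt (PosNum d0).
near=> n.
have n0 : (0 < n)%N by near: n; exact: nbhs_infty_gt.
have N0 : (0 < 2 * n)%N by lia.
have mS : measurable (slice 0 (quantile P (2 * n) 1)) by exact: slice_measurable.
apply: le_lt_trans (dP _ mS _).
  rewrite le_eqVlt; apply/orP; left; apply/eqP; rewrite /I /Rintegral; congr fine.
  apply: eq_integral => x; rewrite inE => -[x0 _].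
  rewrite patchE mem_set; last by rewrite /D/= in_itv/= x0.
  by rewrite /= ger0_norm ?invr_ge0 ?ltW.
have [_ P1] := quantileP N0 N0.
(* For [n >= 1], [n + 1 <= 2n], so 1/(2n) is below the bound 1/(n+1) known to be eventually less
   than [d]. *)
rewrite [ltLHS]P1 lte_fin mul1r; apply: (@le_lt_trans _ _ n.+1%:R^-1).
  by rewrite lef_pV2 ?posrE ?ltr0n// ler_nat; lia.
by near: n.
Unshelve. all: by end_near. Qed.

Lemma quantized_sum_cvg (u : nat -> nat) : (forall m, (0 < u m)%N) -> u @ \oo --> \oo ->
  (\sum_(i < u m) weight P (u m) i.+1 / node P (u m) i.+1)%:E @[m --> \oo]
    --> I `]0, +oo[%classic.
Proof.
move=> u0 uoo.
(* A finite limit reduces the claim to convergence in [R], where the error bound applies. *)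
have If : I `]0, +oo[%classic \is a fin_num by rewrite -slice0y.
rewrite -(fineK If); apply: cvg_EFin; first exact: nearW.
apply/cvgrPdist_lt => e /first_slice_cvg0 small.
near=> m; rewrite distrC; apply: le_lt_trans (quantized_error (u0 m)) _.
by near: m; exact: (uoo _ small).
Unshelve. all: by end_near. Qed.

End Quantiles.

Theorem mainTheorem3 (R : realType) (P : probability (measurableTypeR R) R)
  (hsupp : supported_on_pos P)
  (hdens : has_smooth_density P)
  (hquant : quantiles_unique P)
  (hint : (\int[P]_(r in `]0%R, +oo[%classic) (r^-1)%:E < +oo)%E) :
  ((fun m : nat =>
      \int[quantized P (2 ^ m)%N]_(r in `]0%R, +oo[%classic) (r^-1)%:E)%E @ \oo
    --> (\int[P]_(r in `]0%R, +oo[%classic) (r^-1)%:E)%E)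
  /\
  ((fun m : nat =>
      (\sum_(1 <= i < (2 ^ m)%N.+1)
         weight P (2 ^ m)%N i / node P (2 ^ m)%N i)%:E) @ \oo
    --> (\int[P]_(r in `]0%R, +oo[%classic) (r^-1)%:E)%E).
Proof.
have pow0 m : (0 < 2 ^ m)%N by rewrite expn_gt0.
have powoo : (fun m => 2 ^ m)%N @ \oo --> \oo.
  apply/cvgnyPge => A; near=> m.
  (* Divergence comes from [m < 2 ^ m]. *)
  apply: leq_trans (ltnW (ltn_expl m (ltnSn 1))).
  by near: m; exact: nbhs_infty_ge.
have cvg_sum := quantized_sum_cvg hsupp hquant hint pow0 powoo.
split; first by under eq_fun do rewrite integral_quantized//.
by under eq_fun do rewrite big_add1/= big_mkord.
Unshelve. all: by end_near. Qed.
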